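(* Let $G$ and $H$ be connected graphs, each with at least $3$ vertices. Then $$\tau_3(G\Box H)\geq \min\left\{3\left\lfloor\frac{\tau_3(G)}{2}\right\rfloor,\;3\left\lfloor\frac{\tau_3(H)}{2}\right\rfloor\right\}.$$ Moreover, this bound is sharp, i.e., there exist connected graphs $G$ and $H$ (each with at least $3$ vertices) for which equality holds.
   Context: All graphs are finite, simple and undirected. For a graph $G$ and a set $S\subseteq V(G)$ with $|S|\geq 2$, an $S$-Steiner tree is a subgraph $T$ of $G$ that is a tree with $S\subseteq V(T)$. A pendant $S$-Steiner tree is an $S$-Steiner tree in which every vertex of $S$ has degree exactly $1$. Two pendant $S$-Steiner trees $T,T'$ are internally disjoint if $E(T)\cap E(T')=\varnothing$ and $V(T)\cap V(T')=S$. The local pendant tree-connectivity $\tau_G(S)$ is the maximum number of pairwise internally disjoint pendant $S$-Steiner trees in $G$. For a graph $G$ of order $n$ and an integer $k$ with $2\le k\le n$, the pendant tree $k$-connectivity is $\tau_k(G)=\min\{\tau_G(S): S\subseteq V(G),\ |S|=k\}$ (and $\tau_k(G)=0$ if $G$ is disconnected). The Cartesian product $G\Box H$ has vertex set $V(G)\times V(H)$, with $(u,v)$ adjacent to $(u',v')$ iff either $u=u'$ and $vv'\in E(H)$, or $v=v'$ and $uu'\in E(G)$. *)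

(* Defs.v *)
From mathcomp Require Import all_boot.

Set Implicit Arguments.
Unset Strict Implicit.
Unset Printing Implicit Defensive.

Record sgraph := SGraph {
  vertex :> finType;
  adj : rel vertex;
  adj_sym : symmetric adj;
  adj_irrefl : irreflexive adj
}.

Definition edges (G : sgraph) : {set {set G}} :=
  [set [set p.1; p.2] | p : G * G & adj p.1 p.2].

Definition connected (G : sgraph) : bool :=
  (0 < #|G|) && [forall x : G, forall y : G, connect (@adj G) x y].

Section CartesianProduct.
Variables G H : sgraph.

Definition cart_adj : rel (G * H) := fun p q =>
  (p.1 == q.1) && adj p.2 q.2 || (p.2 == q.2) && adj p.1 q.1.

Lemma cart_adj_sym : symmetric cart_adj.
Proof.
by move=> p q; rewrite /cart_adj (eq_sym p.1) (eq_sym p.2)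
  (adj_sym p.1) (adj_sym p.2).
Qed.

Lemma cart_adj_irrefl : irreflexive cart_adj.
Proof. by move=> p; rewrite /cart_adj !adj_irrefl !andbF. Qed.

Definition cart_prod : sgraph := SGraph cart_adj_sym cart_adj_irrefl.

End CartesianProduct.

Notation "G □ H" := (cart_prod G H) (at level 40, left associativity).

Section SteinerTrees.
Variable G : sgraph.

(* A candidate subgraph (V(T), E(T)); [is_subgraph] is the validity condition. *)
Definition presubgraph : finType := ({set G} * {set {set G}})%type.
Implicit Types (T : presubgraph) (S : {set G}).

Definition sub_vertices T : {set G} := T.1.
Definition sub_edges T : {set {set G}} := T.2.

Definition is_subgraph T : bool :=
  (sub_edges T \subset edges G) &&
  [forall f in sub_edges T, f \subset sub_vertices T].

Definition sub_adj T : rel G := fun x y => [set x; y] \in sub_edges T.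

Definition sub_degree T (x : G) : nat :=
  #|[set f in sub_edges T | x \in f]|.

Definition sub_connected T : bool :=
  (sub_vertices T != set0) &&
  [forall x in sub_vertices T, forall y in sub_vertices T,
     connect (sub_adj T) x y].

(* The bound on the length only serves decidability; see [sub_acyclicP]. *)
Definition sub_acyclic T : bool :=
  [forall n : 'I_#|G|.+1, forall c : n.-tuple G,
     ucycleb (sub_adj T) c ==> (n < 3)].

Lemma sub_acyclicP T :
  reflect (forall c : seq G, ucycle (sub_adj T) c -> size c < 3)
          (sub_acyclic T).
Proof.
apply: (iffP idP) => [acT c uc | acT].
  have ltc : size c < #|G|.+1 by rewrite ltnS; case/andP: uc => _ /card_uniqP <-;
    apply: max_card.
  by move/forallP/(_ (Ordinal ltc))/forallP/(_ (in_tuple c))/implyP: acT; apply.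
apply/forallP => n; apply/forallP => c; apply/implyP => uc.
by have := acT _ uc; rewrite size_tuple.
Qed.

Definition is_tree T : bool :=
  [&& is_subgraph T, sub_connected T & sub_acyclic T].

Definition steiner_tree S T : bool := is_tree T && (S \subset sub_vertices T).

Definition pendant_steiner_tree S T : bool :=
  steiner_tree S T && [forall x in S, sub_degree T x == 1].

Definition internally_disjoint S T T' : bool :=
  (sub_edges T :&: sub_edges T' == set0) &&
  (sub_vertices T :&: sub_vertices T' == S).

Definition pendant_packing S (F : {set presubgraph}) : bool :=
  [forall T in F, pendant_steiner_tree S T] &&
  [forall T in F, forall T' in F, (T != T') ==> internally_disjoint S T T'].

Definition local_tau S : nat :=
  \max_(F : {set presubgraph} | pendant_packing S F) #|F|.

End SteinerTrees.

(* Pendant tree k-connectivity. The initial value of the iterated [minn] is the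
   maximum of the same family, so it never affects the minimum when k <= #|G|
   (see [tau_le] and [tau_attained]). *)
Definition tau (k : nat) (G : sgraph) : nat :=
  if connected G then
    \big[minn/(\max_(S : {set G} | #|S| == k) local_tau S)]_(S : {set G} | #|S| == k)
      local_tau S
  else 0.

Lemma tau_le (k : nat) (G : sgraph) (S : {set G}) :
  #|S| = k -> tau k G <= local_tau S.
Proof.
move=> /eqP cS; rewrite /tau; case: ifP => // _.
set m0 := (X in \big[minn/X]_(_ | _) _).
have: S \in index_enum _ by rewrite mem_index_enum.
elim: (index_enum _) => // A s IHs; rewrite big_cons inE.
case/orP => [/eqP <- | /IHs le_s]; first by rewrite cS geq_minl.
by case: ifP => // _; apply: leq_trans (geq_minr _ _) le_s.
Qed.

Lemma tau_attained (k : nat) (G : sgraph) :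
  connected G -> k <= #|G| ->
  exists2 S : {set G}, #|S| = k & tau k G = local_tau S.
Proof.
move=> conG le_k; rewrite /tau conG.
have [S0 cS0]: exists S : {set G}, #|S| == k.
  have : 0 < #|[set A : {set G} | A \subset [set: G] & #|A| == k]|.
    by rewrite cards_draws cardsT bin_gt0.
  by case/card_gt0P => S; rewrite inE => /andP[_]; exists S.
have [S1 cS1 eS1] := eq_bigmax_cond (@local_tau G)
  (A := [pred S : {set G} | #|S| == k]) (introT card_gt0P (ex_intro _ S0 cS0)).
set P := fun m => exists2 S : {set G}, #|S| = k & m = local_tau S.
apply: (big_ind P) => [|m1 m2 P1 P2|S /eqP cS]; last by exists S.
  by exists S1; [apply/eqP | rewrite -eS1].
by rewrite /minn; case: ifP.
Qed.

(* Main.v *)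
(** Deleting the leaves [S] from a pendant [S]-Steiner tree leaves a connected
    set disjoint from [S] and adjacent to every vertex of [S] (a core); conversely
    a spanning tree of a core extends to a pendant tree. So [local_tau S] is the
    maximal number of pairwise disjoint cores. Let [m >= 2], and let [C i] and [D i]
    ([i < m]) be disjoint cores of 3-sets [S1] and [S2] of [G] and [H]. Then the
    [2 * m] sets [C i × (S2 ∪ D i)] and [(S1 ∪ C (i + 1)) × D i] (indices modulo
    [m]) are disjoint cores of all of [S1 × S2], hence of any 3-set inside it. So
    the product has [tau 3] at least [2 * m] for [m = min (tau 3 G, tau 3 H) >= 2].
    Equality holds (as [0 = 0]) for two paths on 3 vertices, because a corner of
    the 3 × 3 grid has only two neighbours. *)
Require Import Defs.
From mathcomp Require Import all_boot zify.

Set Implicit Arguments.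
Unset Strict Implicit.
Unset Printing Implicit Defensive.

(** * Padding finite sets and comparing unordered pairs *)

Lemma set_card_superset (T : finType) (A : {set T}) k :
  #|A| <= k -> k <= #|T| -> exists2 B : {set T}, A \subset B & #|B| = k.
Proof.
elim: k => [|k IHk]; first by rewrite leqn0 => /eqP A0 _; exists A.
rewrite leq_eqVlt => /orP[/eqP cA _|ltA ltk]; first by exists A.
have [B sAB cB] := IHk ltA (ltnW ltk).
have /card_gt0P[x]: 0 < #|~: B| by have := cardsC B; lia.
rewrite inE => xB; exists (x |: B); last by rewrite cardsU1 xB cB.
exact: subset_trans sAB (subsetUr _ _).
Qed.

Lemma set2_inj (T : finType) (x y z : T) : [set x; y] = [set x; z] -> y = z.
Proof.
move=> e; have : y \in [set x; z] by rewrite -e set22.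
have : z \in [set x; y] by rewrite e set22.
by rewrite !inE => /orP[/eqP ->|/eqP -> //] /orP[] /eqP.
Qed.

(** * Connectivity of induced subgraphs, and cores *)

Section Cores.
Variable G : sgraph.
Implicit Types (T : presubgraph G) (A B C S : {set G}).

(** Kept as a relation on the whole vertex type, so that enlarging [A] merely enlarges the
    relation. *)
Definition induced_adj A : rel G := fun x y => [&& x \in A, y \in A & adj x y].

Definition set_connected A : Prop :=
  A != set0 /\ {in A &, forall x y, connect (induced_adj A) x y}.

Lemma induced_adj_sym A : symmetric (induced_adj A).
Proof. by move=> x y; rewrite /induced_adj adj_sym andbCA. Qed.

Lemma induced_connect_sym A : connect_sym (induced_adj A).
Proof. exact/sym_connect_sym/induced_adj_sym. Qed.

Lemma sub_induced_connect A B : A \subset B ->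
  subrel (connect (induced_adj A)) (connect (induced_adj B)).
Proof.
move=> sAB; apply: connect_sub => x y /and3P[xA yA xy].
by apply: connect1; rewrite /induced_adj !(subsetP sAB) // xy.
Qed.

(** Each vertex of [S] has a neighbour in [A], and these neighbours are linked inside [A]. It makes
    [S :|: C] connected for a core [C] of [S]. *)
Lemma set_connectedU A S : set_connected A ->
  (forall s, s \in S -> exists2 c, c \in A & adj s c) ->
  set_connected (S :|: A).
Proof.
case=> nA cA adjS; split.
  by case/set0Pn: nA => x xA; apply/set0Pn; exists x; rewrite inE xA orbT.
have reach x : x \in S :|: A ->
    exists2 c, c \in A & connect (induced_adj (S :|: A)) x c.
  rewrite inE; case/orP=> xS; last by exists x.
  have [c cc xc] := adjS _ xS; exists c => //.
  by apply: connect1; rewrite /induced_adj !inE xS cc xc orbT.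
move=> x y /reach[c cx xc] /reach[d dx yd].
apply: connect_trans xc _; rewrite induced_connect_sym.
apply: connect_trans yd _; rewrite induced_connect_sym.
by apply: sub_induced_connect (cA _ _ cx dx); apply: subsetUr.
Qed.

Lemma set_connected_setT : connected G -> set_connected [set: G].
Proof.
case/andP=> /card_gt0P[x0 _] /forallP cG; split.
  by apply/set0Pn; exists x0; rewrite inE.
move=> x y _ _; apply: connect_sub (forallP (cG x) y) => u v uv.
by apply: connect1; rewrite /induced_adj !inE uv.
Qed.

Lemma connected_setT : set_connected [set: G] -> connected G.
Proof.
case=> /set0Pn[x0 _] cG; apply/andP; split; first by apply/card_gt0P; exists x0.
apply/forallP=> x; apply/forallP=> y.
apply: connect_sub (cG x y (in_setT _) (in_setT _)) => u v /and3P[_ _ uv].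
exact: connect1.
Qed.

Lemma edgesP (f : {set G}) :
  reflect (exists x y, adj x y /\ f = [set x; y]) (f \in edges G).
Proof.
apply: (iffP imsetP) => [[[x y] xy ->]|[x [y [xy ->]]]].
  by exists x, y; split=> //; rewrite inE in xy.
by exists (x, y); rewrite ?inE.
Qed.

Definition core S C : Prop :=
  [/\ set_connected C, [disjoint C & S] &
      forall s, s \in S -> exists2 c, c \in C & adj s c].

(** * From a pendant Steiner tree to a core *)

Section PendantTree.
Variables (S : {set G}) (T : presubgraph G).
Hypotheses (S_gt2 : 2 < #|S|) (T_pendant : pendant_steiner_tree S T).

Let T_sub : is_subgraph T. Proof. by case/andP: T_pendant => /andP[/and3P[]]. Qed.

Let T_conn : sub_connected T. Proof. by case/andP: T_pendant => /andP[/and3P[]]. Qed.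

Let S_sub : S \subset sub_vertices T.
Proof. by case/andP: T_pendant => /andP[]. Qed.

Lemma sub_adj_sym : symmetric (sub_adj T).
Proof. by move=> x y; rewrite /sub_adj setUC. Qed.

Lemma sub_adjW x y : sub_adj T x y ->
  [/\ adj x y, x \in sub_vertices T & y \in sub_vertices T].
Proof.
move=> xy; case/andP: T_sub => /subsetP sE /forallP/(_ [set x; y]).
rewrite [_ \in _]xy /= subUset !sub1set => /andP[xV yV]; split=> //.
have /edgesP[u [v [uv e]]] := sE _ xy.
have: u \in [set x; y] by rewrite e set21.
have: v \in [set x; y] by rewrite e set22.
by rewrite !inE => /orP[] /eqP ev /orP[] /eqP eu;
  move: uv; rewrite ev eu ?adj_irrefl // adj_sym.
Qed.

Lemma pendant_adj s : s \in S ->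
  exists2 y, sub_adj T s y & forall z, sub_adj T s z -> z = y.
Proof.
move=> sS; case/andP: T_pendant => _ /forallP/(_ s).
rewrite sS => /cards1P[f ef].
have := set11 f; rewrite -ef inE => /andP[fE sf].
case/andP: T_sub => /subsetP/(_ f fE)/edgesP[u [v [uv efuv]]] _.
have [y ey] : exists y, f = [set s; y].
  move: sf; rewrite efuv !inE => /orP[] /eqP ->; first by exists v.
  by exists u; rewrite setUC.
exists y => [|z sz]; first by rewrite /sub_adj -ey.
apply: (@set2_inj _ s); rewrite -ey; apply/set1P; rewrite -ef inE set21 andbT.
exact: sz.
Qed.

(** Two adjacent leaves would form a whole component [[set s; y]] of the tree. Since [S] has a third
    vertex, this contradicts connectedness. *)
Lemma pendant_adj_notin s y : s \in S -> sub_adj T s y -> y \notin S.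
Proof.
move=> sS sy; apply/negP=> yS.
have [s' _ us] := pendant_adj sS; have es' := us _ sy; subst s'.
have [y' _ uy] := pendant_adj yS.
have ey' : s = y' by apply: uy; rewrite sub_adj_sym.
subst y'; have : ~~ (S \subset [set s; y]).
  apply/negP=> /subset_leq_card.
  by rewrite cards2 => le; have := leq_trans S_gt2 le; case: (s != y).
case/subsetPn=> z zS /negP; apply.
have cl : closed (sub_adj T) [set s; y].
  apply: intro_closed; first exact/sym_connect_sym/sub_adj_sym.
  move=> u v uv; rewrite !inE => /orP[] /eqP eu; move: uv; rewrite eu.
    by move/us ->; rewrite eqxx orbT.
  by move/uy ->; rewrite eqxx.
case/andP: T_conn => _ /forallP/(_ s)/implyP/(_ (subsetP S_sub _ sS)).
move/forallP/(_ z)/implyP/(_ (subsetP S_sub _ zS)) => /(closed_connect cl) <-.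
by rewrite set21.
Qed.

Lemma pendant_tree_core : core S (sub_vertices T :\: S).
Proof.
have adjS s : s \in S -> exists2 c, c \in sub_vertices T :\: S & adj s c.
  move=> sS; have [y sy _] := pendant_adj sS; have [a _ yV] := sub_adjW sy.
  by exists y => //; rewrite in_setD yV (pendant_adj_notin sS sy).
split=> //; last by apply/pred0P=> x; rewrite /= !inE; case: (x \in S); rewrite ?andbF.
split.
  have /card_gt0P[s sS]: 0 < #|S| by apply: leq_trans S_gt2.
  by have [c cC _] := adjS _ sS; apply/set0Pn; exists c.
(* Contracting each leaf onto its neighbour maps the tree onto the core. *)
pose phi x := if x \in S then odflt x [pick y | sub_adj T x y] else x.
(* A leaf has exactly one neighbour, so the default of [odflt] is never reached for it. *)
have phiS s y : s \in S -> sub_adj T s y -> phi s = y.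
  move=> sS sy; rewrite /phi sS; case: pickP => [z sz|/(_ y)]; last by rewrite sy.
  by have [t _ u] := pendant_adj sS; rewrite (u _ sz) (u _ sy).
have phiN x : x \notin S -> phi x = x by rewrite /phi => /negPf ->.
set e := induced_adj _.
(* An edge at a leaf collapses to a point; every other edge survives in the core. *)
have step x y : sub_adj T x y -> connect e (phi x) (phi y).
  move=> xy; have yx : sub_adj T y x by rewrite sub_adj_sym.
  have [xS|xS] := boolP (x \in S).
    by rewrite (phiS x y) // phiN // (pendant_adj_notin xS xy).
  have [yS|yS] := boolP (y \in S); first by rewrite (phiS y x) // phiN.
  have [a xV yV] := sub_adjW xy; rewrite !phiN //; apply: connect1.
  by rewrite /e /induced_adj !inE xS yS xV yV.
move=> x y; rewrite !inE => /andP[xS xV] /andP[yS yV].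
rewrite -[x]phiN // -[y]phiN //; case/andP: T_conn => _ /forallP/(_ x).
rewrite xV => /forallP/(_ y); rewrite yV => /connectP[p + ->].
elim: p x {xS xV} => //= z p IHp x /andP[xz zp].
exact: connect_trans (step _ _ xz) (IHp _ zp).
Qed.

(** Trees that meet only in [S] can share only edges inside [S]; this excludes such edges. *)
Lemma pendant_edge_notin f : f \in sub_edges T -> ~~ (f \subset S).
Proof.
move=> fE; case/andP: T_sub => /subsetP/(_ f fE)/edgesP[u [v [_ e]]] _.
rewrite e subUset !sub1set; apply/negP=> /andP[uS]; apply/negP.
by apply: (pendant_adj_notin uS); rewrite /sub_adj -e.
Qed.

End PendantTree.

(** * Trees grown leaf by leaf, and from a core back to a pendant tree *)

Definition add_leaf T x y : presubgraph G :=
  (y |: sub_vertices T, [set x; y] |: sub_edges T).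

Lemma tree1 x : is_tree (([set x], set0) : presubgraph G).
Proof.
apply/and3P; split.
- by apply/andP; split; [apply: sub0set | apply/forallP=> f; rewrite inE].
- apply/andP; split; first by apply/set0Pn; exists x; rewrite inE.
  apply/forallP=> u; apply/implyP=> /set1P ->.
  by apply/forallP=> v; apply/implyP=> /set1P ->.
- apply/sub_acyclicP=> -[|y c] // /andP[/=].
  by case: c => [|z c] /=; rewrite /sub_adj inE.
Qed.

Lemma add_leaf_degree T x y z : [set x; y] \notin sub_edges T ->
  sub_degree (add_leaf T x y) z = (z \in [set x; y]) + sub_degree T z.
Proof.
move=> nE; rewrite /sub_degree.
have [zxy|zxy] := boolP (z \in [set x; y]).
  (* The added 1 is turned into a membership test so that [cardsU1] applies from right to left. *)
  rewrite -[RHS]/(true + _) -(_ : [set x; y] \notin [set f in sub_edges T | z \in f] = true).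
    rewrite -cardsU1; congr #|pred_of_set _|.
    by apply/setP=> f; rewrite !inE; case: eqP => [->|].
  by rewrite inE (negPf nE).
congr #|pred_of_set _|; apply/setP=> f; rewrite !inE; case: eqP => // -> /=.
by rewrite (negPf nE) (negPf zxy).
Qed.

Lemma tree_edge_subset T f :
  is_tree T -> f \in sub_edges T -> f \subset sub_vertices T.
Proof. by case/and3P=> /andP[_ /forallP/(_ f)/implyP]. Qed.

Lemma degree_notin T z : is_tree T -> z \notin sub_vertices T -> sub_degree T z = 0.
Proof.
move=> tT zV; apply/eqP; rewrite cards_eq0; apply/eqP/setP=> f; rewrite !inE.
apply/negP=> /andP[fE zf]; case/negP: zV.
exact: (subsetP (tree_edge_subset tT fE)).
Qed.

Lemma add_leaf_tree T x y : is_tree T -> x \in sub_vertices T ->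
  y \notin sub_vertices T -> adj x y -> is_tree (add_leaf T x y).
Proof.
move=> tT xV yV xy; case/and3P: (tT) => /andP[sE _] /andP[_ /forallP cT].
move=> /sub_acyclicP aT.
(* An old edge at [y] would put [y] among the old vertices, so [x] is its only neighbour. *)
have leafE z : sub_adj (add_leaf T x y) y z -> z = x.
  rewrite /sub_adj in_setU1 => /orP[/eqP e|].
    by apply: (@set2_inj _ y); rewrite e setUC.
  by move/(tree_edge_subset tT); rewrite subUset sub1set (negPf yV).
have leafS u v : sub_adj (add_leaf T x y) u v -> sub_adj (add_leaf T x y) v u.
  by rewrite /sub_adj setUC.
apply/and3P; split.
- apply/andP; split.
    rewrite subUset sE andbT sub1set; apply/edgesP; by exists x, y.
  apply/forallP=> f; apply/implyP; rewrite !inE => /orP[/eqP ->|/(tree_edge_subset tT) fV].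
    by rewrite subUset !sub1set !inE eqxx xV orbT.
  exact: subset_trans fV (subsetUr _ _).
- apply/andP; split; first by apply/set0Pn; exists y; rewrite !inE eqxx.
  have toX z : z \in y |: sub_vertices T -> connect (sub_adj (add_leaf T x y)) x z.
    rewrite in_setU1 => /orP[/eqP ->|zV].
      by apply: connect1; rewrite /sub_adj !inE eqxx.
    have := cT x; rewrite xV => /forallP/(_ z); rewrite zV.
    apply: connect_sub => u v uv; apply: connect1.
    by rewrite /sub_adj in_setU1 [_ \in _]uv orbT.
  apply/forallP=> u; apply/implyP=> /toX xu.
  apply/forallP=> v; apply/implyP=> /toX xv; apply: connect_trans xv.
  by rewrite sym_connect_sym // => a b; apply/idP/idP; apply: leafS.
(* A leaf cannot lie on a cycle of length at least 3: its two neighbours on the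
   cycle would both be [x]. *)
- apply/sub_acyclicP=> c /andP[cyc uc].
  have [yc|yc] := boolP (y \in c).
    have [i p e] := rot_to yc.
    rewrite -(size_rot i) e; move: cyc uc; rewrite -(rot_cycle i) -(rot_uniq i) e.
    case: p {e} => [|z [|t p]] // /= /andP[yz]; rewrite rcons_path.
    case/and3P=> _ _ /leafS /leafE el /and4P[_ zp _ _].
    by case/negP: zp; rewrite (leafE _ yz) -el mem_last.
  (* A cycle avoiding [y] uses old edges only. *)
  apply: aT; apply/andP; split=> //; apply: (@sub_in_cycle _ [in c]) cyc; last exact/allP.
  move=> u v uc' vc; rewrite /sub_adj in_setU1 => /orP[/eqP e|//].
  have : y \in [set u; v] by rewrite e set22.
  by rewrite !inE => /orP[] /eqP ey;
    rewrite ey ?uc' ?vc in yc.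
Qed.

(** A tree inside [C] that does not yet cover [C] has an edge of [C] leaving it, along which a leaf
    is added. *)
Lemma spanning_tree C : set_connected C ->
  exists2 T, is_tree T & sub_vertices T = C.
Proof.
case=> /set0Pn[x0 x0C] cC.
have: forall n, n < #|C| ->
  exists T, [/\ is_tree T, sub_vertices T \subset C & #|sub_vertices T| = n.+1].
  elim=> [|n IHn] ltn.
    exists ([set x0], set0); rewrite cards1 sub1set; split=> //; exact: tree1.
  have [T [tT sTC cT]] := IHn (ltnW ltn).
  have [x xV [y yC [yV xy]]] : exists2 x, x \in sub_vertices T &
      exists2 y, y \in C & y \notin sub_vertices T /\ adj x y.
    have [/existsP[x /andP[xV /existsP[y /and3P[yC yV xy]]]]|none] := boolP
      [exists x, (x \in sub_vertices T) &&
        [exists y, [&& y \in C, y \notin sub_vertices T & adj x y]]].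
      by exists x => //; exists y.
    (* Without a leaving edge the tree's vertex set would be a union of components of [C],
       impossible for a nonempty proper subset. *)
    have cl : closed (induced_adj C) (sub_vertices T).
      apply: intro_closed; first exact: induced_connect_sym.
      move=> x y /and3P[_ yC xy] xV; apply: contraR none => yV.
      apply/existsP; exists x; rewrite xV; apply/existsP; exists y.
      by rewrite yC yV.
    have [z zC zV] : exists2 z, z \in C & z \notin sub_vertices T.
      apply/subsetPn/negP=> /subset_leq_card; rewrite cT leqNgt; exact/negP/negPn.
    have /card_gt0P[t tV] : 0 < #|sub_vertices T| by rewrite cT.
    have := closed_connect cl (cC _ _ (subsetP sTC _ tV) zC).
    by rewrite tV (negPf zV).
  exists (add_leaf T x y); split; first exact: add_leaf_tree.
    by rewrite subUset sub1set yC.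
  by rewrite cardsU1 yV cT.
move=> /(_ #|C|.-1); rewrite prednK; last by apply/card_gt0P; exists x0.
case=> [//|T [tT sTC cT]].
by exists T => //; apply/eqP; rewrite eqEcard sTC cT /=.
Qed.

(** The vertices of [S] are hung one by one as leaves on a spanning tree of [C]. Each is attached to
    a vertex of [C], never to an earlier leaf, so earlier leaves keep degree 1. *)
Lemma core_pendant_tree S C : core S C ->
  exists2 T, pendant_steiner_tree S T & sub_vertices T = S :|: C.
Proof.
case=> conC disC adjS.
have [T0 tT0 vT0] := spanning_tree conC.
have: forall n, n <= #|S| -> exists T (A : {set G}),
   [/\ A \subset S, #|A| = n, is_tree T, sub_vertices T = A :|: C &
       {in A, forall s, sub_degree T s = 1}].
  elim=> [|n IHn] len.
    by exists T0, set0; rewrite sub0set cards0 set0U; split=> // s; rewrite inE.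
  have [T [A [sAS cA tT vT dT]]] := IHn (ltnW len).
  have [s sS sA] : exists2 s, s \in S & s \notin A.
    apply/subsetPn/negP=> /subset_leq_card; rewrite cA leqNgt; exact/negP/negPn.
  have [c cc sc] := adjS _ sS.
  have sC : s \notin C by rewrite (disjointFl disC).
  have sV : s \notin sub_vertices T by rewrite vT inE negb_or sA.
  have nE : [set c; s] \notin sub_edges T.
    apply/negP=> /(tree_edge_subset tT).
    by rewrite subUset !sub1set (negPf sV) andbF.
  exists (add_leaf T c s), (s |: A); split.
  - by rewrite subUset sub1set sS.
  - by rewrite cardsU1 sA cA.
  - by apply: add_leaf_tree; rewrite // ?vT ?inE ?cc ?orbT // adj_sym.
  - by rewrite /sub_vertices /= -/(sub_vertices T) vT setUA.
  - move=> z; rewrite in_setU1 add_leaf_degree //.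
    case/orP=> [/eqP ->|zA]; first by rewrite set22 degree_notin.
    (* An earlier leaf [z] is neither end of the new edge: [c] lies in [C], and [s] was not yet
       attached. *)
    have zC : z \notin C by rewrite (disjointFl disC) // (subsetP sAS).
    rewrite dT // !inE.
    have /negPf -> : z != s by apply: contraNneq sA => <-.
    have /negPf -> // : z != c by apply: contraNneq zC => ->.
case/(_ _ (leqnn _)) => T [A [sAS cA tT vT dT]].
have eAS : A = S by apply/eqP; rewrite eqEcard sAS cA /=.
subst A; exists T => //; apply/andP; split.
  by apply/andP; split; rewrite // vT subsetUl.
by apply/forallP=> s; apply/implyP=> /dT ->.
Qed.

(** * Packings of pendant trees as families of disjoint cores *)

Lemma local_tau_cores S m : 2 < #|S| -> m <= local_tau S ->
  exists C : 'I_m -> {set G}, (forall i, core S (C i)) /\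
    (forall i j, i != j -> [disjoint C i & C j]).
Proof.
move=> S_gt2 le_m.
(* The empty family is a packing, so the maximum is attained by some [F]; [m] of its members are
   then selected. *)
have pack0 : 0 < #|[pred F | pendant_packing S F]|.
  apply/card_gt0P; exists set0.
  by rewrite inE; apply/andP; split; apply/forallP=> T; rewrite inE.
have [F pF eF] := eq_bigmax_cond (fun F : {set presubgraph G} => #|F|) pack0.
have {}le_m : m <= #|F| by rewrite -eF.
case/andP: pF => /forallP pF /forallP dF.
pose T (i : 'I_m) : presubgraph G := enum_val (widen_ord le_m i).
have TF i : T i \in F by apply: enum_valP.
have pT i : pendant_steiner_tree S (T i).
  by have := pF (T i); rewrite TF.
exists (fun i => sub_vertices (T i) :\: S); split=> [i|i j neq_ij].
  exact: pendant_tree_core.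
have neqT : T i != T j.
  by apply: contraNneq neq_ij => /enum_val_inj [] /val_inj ->.
have := dF (T i); rewrite TF => /forallP/(_ (T j)); rewrite TF neqT.
case/andP=> _ /eqP VS; apply/pred0P=> x /=; rewrite !inE.
apply/negP=> /andP[/andP[xS xi] /andP[_ xj]]; case/negP: xS.
by rewrite -VS inE xi xj.
Qed.

(** The trees built on disjoint cores meet exactly in [S], and no edge lies inside [S], so they
    share no edge. The index type is arbitrary so that two families can be joined as a sum type. *)
Lemma cores_local_tau S (I : finType) (C : I -> {set G}) : 2 < #|S| ->
  (forall i, core S (C i)) -> (forall i j, i != j -> [disjoint C i & C j]) ->
  #|I| <= local_tau S.
Proof.
move=> S_gt2 coreC disC.
have [T /all_and2[pT vT]] : exists T : I -> presubgraph G,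
    forall i, pendant_steiner_tree S (T i) /\ sub_vertices (T i) = S :|: C i.
  apply: (@fin_all_exists I (fun=> presubgraph G) (fun i T => pendant_steiner_tree S T /\ sub_vertices T = S :|: C i)) => i.
  by have [T pT vT] := core_pendant_tree (coreC i); exists T.
have vTI i j : i != j -> sub_vertices (T i) :&: sub_vertices (T j) = S.
  by move=> /disC/disjoint_setI0 e; rewrite !vT -setUIr e setU0.
(* Equal trees for distinct indices would have vertex set [S], leaving no room for the nonempty
   core. *)
have injT : injective T.
  move=> i j e; apply/eqP/negPn/negP=> /vTI; rewrite -e setIid vT => eS.
  have [[/set0Pn[x xC] _] dS _] := coreC i.
  by have := disjointFr dS xC; rewrite -eS inE xC orbT.
rewrite -(card_imset predT injT); apply: leq_bigmax_cond.
apply/andP; split.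
  by apply/forallP=> U; apply/implyP=> /imsetP[i _ ->].
apply/forallP=> U; apply/implyP=> /imsetP[i _ ->].
apply/forallP=> U'; apply/implyP=> /imsetP[j _ ->]; apply/implyP=> neqT.
have neq_ij : i != j by apply: contraNneq neqT => ->.
apply/andP; split; last by rewrite vTI.
apply/eqP/setP=> f; rewrite !inE; apply/negP=> /andP[fi fj].
have treeT k : is_tree (T k) by case/andP: (pT k) => /andP[].
case/negP: (pendant_edge_notin S_gt2 (pT i) fi).
by rewrite -(vTI _ _ neq_ij) subsetI !tree_edge_subset.
Qed.

End Cores.

(** * Cores in Cartesian products *)

Lemma sub_core (G : sgraph) (S S' C : {set G}) :
  S \subset S' -> core S' C -> core S C.
Proof.
move=> sSS' [cC dC aC]; split=> //; first exact: disjointWr dC.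
by move=> s /(subsetP sSS')/aC.
Qed.

(** Walk first in the row through [x2] to the column of [y1], then along that column. *)
Lemma setX_connected (G H : sgraph) (A : {set G}) (B : {set H}) :
  set_connected A -> set_connected B ->
  @set_connected (G □ H) (setX A B).
Proof.
case=> /set0Pn[a aA] cA [/set0Pn[b bB] cB]; split.
  by apply/set0Pn; exists (a, b); rewrite in_setX aA.
move=> [x1 x2] [y1 y2]; rewrite !in_setX /= => /andP[x1A x2B] /andP[y1A y2B].
set e := induced_adj _.
have horizontal p : path (induced_adj A) x1 p -> connect e (x1, x2) (last x1 p, x2).
  elim: p x1 {x1A} => //= z p IHp x /andP[/and3P[xA zA xz] zp].
  apply: connect_trans (IHp _ zp); apply: connect1.
  by rewrite /e /induced_adj !in_setX xA zA x2B /= /cart_adj /= eqxx xz orbT.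
have vertical p : path (induced_adj B) x2 p -> connect e (y1, x2) (y1, last x2 p).
  elim: p x2 {x2B horizontal} => //= z p IHp x /andP[/and3P[xB zB xz] zp].
  apply: connect_trans (IHp _ zp); apply: connect1.
  by rewrite /e /induced_adj !in_setX y1A xB zB /= /cart_adj /= eqxx xz.
have /connectP[p pA ep] := cA _ _ x1A y1A.
have /connectP[q qB eq] := cB _ _ x2B y2B.
apply: connect_trans (_ : connect e (y1, x2) _); last by rewrite eq; apply: vertical.
by rewrite [in X in connect _ _ X]ep; apply: horizontal.
Qed.

Lemma cart_connected (G H : sgraph) :
  connected G -> connected H -> connected (G □ H).
Proof.
move=> /set_connected_setT cG /set_connected_setT cH; apply: connected_setT.
have -> : [set: G □ H] = setX [set: G] [set: H] by apply/setP=> p; rewrite !inE.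
exact: setX_connected.
Qed.

(** The point [(s1, s2)] enters the core by moving [s1] to a neighbour in [C] with [s2] fixed, which
    is why the second factor contains [S2]. The part [D] is there to connect [S2]. *)
Lemma core_setXl (G H : sgraph) (S1 C : {set G}) (S2 D : {set H}) :
  core S1 C -> core S2 D -> @core (G □ H) (setX S1 S2) (setX C (S2 :|: D)).
Proof.
move=> [cC dC aC] [cD dD aD]; split.
- by apply: setX_connected => //; apply: set_connectedU.
- apply/pred0P=> -[x1 x2] /=; rewrite !in_setX /=.
  by have [x1C|] := boolP (x1 \in C); rewrite ?(disjointFr dC x1C) ?andbF.
- move=> [s1 s2]; rewrite in_setX /= => /andP[/aC[c cc s1c] s2S].
  exists (c, s2); first by rewrite in_setX /= inE cc s2S.
  by rewrite /= /cart_adj /= eqxx s1c orbT.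
Qed.

Lemma core_setXr (G H : sgraph) (S1 C : {set G}) (S2 D : {set H}) :
  core S1 C -> core S2 D -> @core (G □ H) (setX S1 S2) (setX (S1 :|: C) D).
Proof.
move=> [cC dC aC] [cD dD aD]; split.
- by apply: setX_connected => //; apply: set_connectedU.
- apply/pred0P=> -[x1 x2] /=; rewrite !in_setX /=.
  by have [x2D|] := boolP (x2 \in D); rewrite ?(disjointFr dD x2D) ?andbF.
- move=> [s1 s2]; rewrite in_setX /= => /andP[s1S /aD[d dd s2d]].
  exists (s1, d); first by rewrite in_setX /= inE dd s1S.
  by rewrite /= /cart_adj /= eqxx s2d.
Qed.

(** * The packing with a cyclic shift *)

Lemma disjoint_setXl (T1 T2 : finType) (A A' : {set T1}) (B B' : {set T2}) :
  [disjoint A & A'] -> [disjoint setX A B & setX A' B'].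
Proof.
move=> d; apply/pred0P=> -[x1 x2] /=; rewrite !in_setX /=.
by have [x1A|] := boolP (x1 \in A); rewrite ?(disjointFr d x1A) ?andbF.
Qed.

Lemma disjoint_setXr (T1 T2 : finType) (A A' : {set T1}) (B B' : {set T2}) :
  [disjoint B & B'] -> [disjoint setX A B & setX A' B'].
Proof.
move=> d; apply/pred0P=> -[x1 x2] /=; rewrite !in_setX /=.
by have [x1A|] := boolP (x2 \in B); rewrite ?(disjointFr d x1A) ?andbF.
Qed.

(** Sets of the same kind are separated by the disjoint [C i] or the disjoint [D i]. The shift
    [ordS] serves the remaining clash, between the two kinds at the same index. *)
Lemma local_tau_cart (G H : sgraph) (S1 : {set G}) (S2 : {set H})
    (S : {set G □ H}) (m : nat) :
  1 < m -> 2 < #|S1| -> 2 < #|S2| -> 2 < #|S| -> S \subset setX S1 S2 ->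
  m <= local_tau S1 -> m <= local_tau S2 -> m + m <= local_tau S.
Proof.
move=> m_gt1 c1 c2 cS sS /(local_tau_cores c1)[C [coreC disC]].
move=> /(local_tau_cores c2)[D [coreD disD]].
pose E (k : 'I_m + 'I_m) : {set G □ H} :=
  match k with
  | inl i => setX (C i) (S2 :|: D i)
  | inr i => setX (S1 :|: C (ordS i)) (D i)
  end.
(* Here [1 < m] enters: for [m = 1] the shift would be the identity. *)
have ordS_neq (i : 'I_m) : ordS i != i.
  apply/eqP=> /(congr1 val) /=; have := ltn_ord i.
  rewrite leq_eqVlt => /orP[/eqP e|lt]; last by rewrite modn_small //; lia.
  by rewrite e modnn; lia.
have mixed i j : [disjoint E (inl i) & E (inr j)].
  (* At equal indices the first coordinates separate, as [C i] misses both [S1] and the shifted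
     core; at distinct indices the second coordinates do. *)
  have [<-|neq_ij] := eqVneq i j.
    have [_ d1 _] := coreC i; apply: disjoint_setXl.
    by rewrite -setI_eq0 setIUr setU_eq0 !setI_eq0 d1 disC // eq_sym.
  have [_ d2 _] := coreD j; apply: disjoint_setXr.
  by rewrite -setI_eq0 setIUl setU_eq0 !setI_eq0 disD // andbT disjoint_sym.
rewrite -[in X in X <= _](card_ord m) -card_sum.
apply: (@cores_local_tau _ _ _ E) => // [[] i|[] i [] j neq_ij].
- by apply: sub_core sS _; apply: core_setXl.
- by apply: sub_core sS _; apply: core_setXr.
- by apply: disjoint_setXl; apply: disC; apply: contraNneq neq_ij => ->.
- exact: mixed.
- by rewrite disjoint_sym; apply: mixed.
- by apply: disjoint_setXr; apply: disD; apply: contraNneq neq_ij => ->.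
Qed.

Lemma tau_cart (G H : sgraph) (m : nat) :
  connected G -> connected H -> 3 <= #|G| -> 3 <= #|H| -> 1 < m ->
  m <= tau 3 G -> m <= tau 3 H -> m + m <= tau 3 (G □ H).
Proof.
move=> cG cH G3 H3 m_gt1 mG mH.
have GH3 : 3 <= #|G □ H| by rewrite card_prod; nia.
have [S cS ->] := tau_attained (cart_connected cG cH) GH3.
(* The projections of [S] may have fewer than three points; they are padded to exactly three so that
   the values of [tau 3] on the factors apply. *)
have [S1 sS1 cS1] : exists2 S1 : {set G}, [set p.1 | p in S] \subset S1 & #|S1| = 3.
  by apply: set_card_superset => //; rewrite -cS leq_imset_card.
have [S2 sS2 cS2] : exists2 S2 : {set H}, [set p.2 | p in S] \subset S2 & #|S2| = 3.
  by apply: set_card_superset => //; rewrite -cS leq_imset_card.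
apply: (@local_tau_cart _ _ S1 S2); rewrite ?cS1 ?cS2 ?cS //.
- apply/subsetP=> -[p1 p2] pS; rewrite in_setX.
  by rewrite (subsetP sS1 _ (imset_f fst pS)) (subsetP sS2 _ (imset_f snd pS)).
- exact: leq_trans mG (tau_le cS1).
- exact: leq_trans mH (tau_le cS2).
Qed.

(** * Sharpness: the 3 by 3 grid *)

Definition path3_adj : rel 'I_3 := fun i j => (j == i.+1 :> nat) || (i == j.+1 :> nat).

Lemma path3_adj_sym : symmetric path3_adj.
Proof. by move=> i j; rewrite /path3_adj orbC. Qed.

Lemma path3_adj_irrefl : irreflexive path3_adj.
Proof. by move=> i; rewrite /path3_adj; lia. Qed.

Definition path3 : sgraph := SGraph path3_adj_sym path3_adj_irrefl.

Lemma path3_connected : connected path3.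
Proof.
apply/andP; split; first by rewrite card_ord.
(* The middle vertex 1 is adjacent to both ends. *)
have toM (i : path3) : connect (@adj path3) i (inord 1).
  have [->//|neq] := eqVneq i (inord 1).
  apply: connect1; rewrite /= /path3_adj; move: neq.
  by rewrite -val_eqE /= !inordK //; have := ltn_ord i; lia.
apply/forallP=> i; apply/forallP=> j; apply: connect_trans (toM i) _.
by rewrite sym_connect_sym //; exact: path3_adj_sym.
Qed.

(** Take for [S] a corner and its only two neighbours: a core would have to contain a neighbour of
    the corner outside [S]. *)
Lemma tau_path3_cart : tau 3 (path3 □ path3) = 0.
Proof.
pose o : path3 := inord 0; pose i : path3 := inord 1.
pose S : {set path3 □ path3} := [set (o, o); (o, i); (i, o)].
have oi : (o == i) = false by rewrite -val_eqE /= !inordK.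
have io : (i == o) = false by rewrite eq_sym.
have cS : #|S| = 3.
  by rewrite /S -setUA cardsU1 cards2 !inE !xpair_eqE !eqxx ?oi ?io.
apply/eqP; rewrite -leqn0; apply: leq_trans (tau_le cS) _.
rewrite leqNgt; apply/negP=> /(@local_tau_cores _ S 1); rewrite cS.
case=> // C [/(_ ord0)[_ dis adjS] _].
have [|[c1 c2] cC] := adjS (o, o); first by rewrite !inE eqxx.
have := disjointFr dis cC; rewrite !inE !xpair_eqE.
rewrite -!val_eqE /= /cart_adj /= /path3_adj -!val_eqE /= !inordK //; lia.
Qed.

(** * The lower bound and a case of equality *)

Theorem theorem1p4 :
  (forall G H : sgraph,
     connected G -> connected H -> 3 <= #|G| -> 3 <= #|H| ->
     minn (3 * (tau 3 G %/ 2)) (3 * (tau 3 H %/ 2)) <= tau 3 (G □ H))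
  /\
  (exists G H : sgraph,
     [/\ connected G, connected H, 3 <= #|G|, 3 <= #|H| &
         tau 3 (G □ H) = minn (3 * (tau 3 G %/ 2)) (3 * (tau 3 H %/ 2))]).
Proof.
have bound (G H : sgraph) :
     connected G -> connected H -> 3 <= #|G| -> 3 <= #|H| ->
     minn (3 * (tau 3 G %/ 2)) (3 * (tau 3 H %/ 2)) <= tau 3 (G □ H).
  (* With [m] the smaller of the two connectivities, the left side is [3 * (m %/ 2)]. It vanishes
     for [m <= 1] and is at most [m + m] otherwise. *)
  move=> cG cH G3 H3; have [|m_gt1] := leqP (minn (tau 3 G) (tau 3 H)) 1; first lia.
  have := tau_cart cG cH G3 H3 m_gt1 (geq_minl _ _) (geq_minr _ _); lia.
split=> //; exists path3, path3.
have c3 : 3 <= #|path3| by rewrite card_ord.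
split=> //; try exact: path3_connected.
(* The bound itself forces the right-hand side to be 0, so [tau 3 path3] is never computed. *)
have := bound _ _ path3_connected path3_connected c3 c3.
by rewrite tau_path3_cart leqn0 => /eqP ->.
Qed.
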